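(* Let $p$ be a prime, let $m\ge 0$ be an integer, and let $f:\mathbb{Z}_p\to\mathbb{Z}_p$ be an analytic function of level $m$. Let $I'=\{\beta=(\beta_0,\dots,\beta_{m-1})\in\mathbb{Z}^m : 0\le\beta_0,\dots,\beta_{m-1}\le p-1\}$. Then there exists a unique restricted power series $F\in\mathbb{Z}_p[[x_0,x_1,\dots,x_m]]$ such that (1) $F(x_0,\dots,x_m)=\sum_{n\ge 0}\sum_{\beta\in I'} a_{\beta,n}\,x_0^{\beta_0}x_1^{\beta_1}\cdots x_{m-1}^{\beta_{m-1}}x_m^n$ for some $a_{\beta,n}\in\mathbb{Z}_p$ (i.e. every monomial of $F$ has degree at most $p-1$ in each of $x_0,\dots,x_{m-1}$), and (2) $f(a)=F(a,\delta a,\dots,\delta^m a)$ for all $a\in\mathbb{Z}_p$.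
   Context: $\mathbb{Z}_p$ denotes the ring of $p$-adic integers with the $p$-adic norm $|\cdot|_p$, $|p|_p=p^{-1}$. The Fermat quotient operator is $\delta:\mathbb{Z}_p\to\mathbb{Z}_p$, $\delta a=(a-a^p)/p$, and $\delta^i$ denotes its $i$-th iterate. A power series $F=\sum_{\alpha} a_\alpha x^\alpha\in\mathbb{Z}_p[[x_0,\dots,x_k]]$ is called restricted if $a_\alpha\to 0$ $p$-adically as $|\alpha|=\alpha_0+\dots+\alpha_k\to\infty$. A function $f:\mathbb{Z}_p\to\mathbb{Z}_p$ is analytic of level $m$ if for every $a\in\mathbb{Z}_p$ there is a restricted power series $F_a\in\mathbb{Z}_p[[x]]$ (one variable) such that $f(a+p^m u)=F_a(u)$ for all $u\in\mathbb{Z}_p$. For $m=0$, $I'$ consists of the single empty tuple and condition (1) says $F=\sum_n a_n x_0^n$. *)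

(* Defs.v *)
From mathcomp Require Import all_boot.

Set Implicit Arguments.
Unset Strict Implicit.
Unset Printing Implicit Defensive.

(* Digits are in 'I_(p.-1).+1, which is 'I_p whenever p > 0 (p prime). *)
Definition Zp (p : nat) : Type := nat -> 'I_(p.-1).+1.

Definition res (p : nat) (x : Zp p) (n : nat) : nat :=
  \sum_(i < n) (x i : nat) * p ^ i.

(* the p-adic integer whose residue mod p^n is r n (for a compatible r) *)
Definition of_res (p : nat) (r : nat -> nat) : Zp p :=
  fun i => inord ((r i.+1 %/ p ^ i) %% p).

Definition zeroZ (p : nat) : Zp p := fun _ => inord 0.
Definition natZ (p : nat) (k : nat) : Zp p := of_res p (fun _ => k).
Definition oneZ (p : nat) : Zp p := natZ p 1.
Definition addZ (p : nat) (x y : Zp p) : Zp p :=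
  of_res p (fun n => res x n + res y n).
Definition mulZ (p : nat) (x y : Zp p) : Zp p :=
  of_res p (fun n => res x n * res y n).
Definition oppZ (p : nat) (x : Zp p) : Zp p :=
  of_res p (fun n => p ^ n - res x n).
Definition subZ (p : nat) (x y : Zp p) : Zp p := addZ x (oppZ y).
Definition powZ (p : nat) (x : Zp p) (k : nat) : Zp p := iter k (mulZ x) (oneZ p).

(* exact division by p of an element divisible by p: shift of digits *)
Definition divpZ (p : nat) (x : Zp p) : Zp p := fun i => x i.+1.

Definition delta (p : nat) (a : Zp p) : Zp p := divpZ (subZ a (powZ a p)).

Definition eqmodZ (p : nat) (k : nat) (x y : Zp p) : Prop :=
  forall i, i < k -> x i = y i.

Definition mindex (k : nat) := {ffun 'I_k -> nat}.
Definition mdeg (k : nat) (al : mindex k) : nat := \sum_(i < k) al i.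

Definition pseries (p k : nat) := mindex k -> Zp p.

Definition restricted (p k : nat) (F : pseries p k) : Prop :=
  forall e, exists N, forall al : mindex k, N <= mdeg al ->
    eqmodZ e (F al) (zeroZ p).

Definition monom (p k : nat) (x : 'I_k -> Zp p) (al : mindex k) : Zp p :=
  foldr (fun i acc => mulZ (powZ (x i) (al i)) acc) (oneZ p) (enum 'I_k).

Definition box_index (k N : nat) (b : {ffun 'I_k -> 'I_N.+1}) : mindex k :=
  [ffun i => nat_of_ord (b i)].

Definition psum (p k : nat) (F : pseries p k) (x : 'I_k -> Zp p) (N : nat) : Zp p :=
  foldr (@addZ p) (zeroZ p)
    [seq mulZ (F (box_index b)) (monom x (box_index b))
    | b <- (enum predT : seq {ffun 'I_k -> 'I_N.+1})].

Definition series_eval (p k : nat) (F : pseries p k) (x : 'I_k -> Zp p) (L : Zp p)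
  : Prop :=
  forall e, exists N0, forall N, N0 <= N -> eqmodZ e (psum F x N) L.

Definition analytic_level (p m : nat) (f : Zp p -> Zp p) : Prop :=
  forall a : Zp p, exists Fa : pseries p 1, restricted Fa /\
    forall u : Zp p,
      series_eval Fa (fun _ => u) (f (addZ a (mulZ (natZ p (p ^ m)) u))).

Definition low_degree (p m : nat) (F : pseries p m.+1) : Prop :=
  forall al : mindex m.+1, (exists i : 'I_m.+1, (i < m) && (p <= al i)) ->
    F al = zeroZ p.

Definition represents (p m : nat) (f : Zp p -> Zp p) (F : pseries p m.+1) : Prop :=
  forall a : Zp p, series_eval F (fun i : 'I_m.+1 => iter i (@delta p) a) (f a).

(* Main.v *)
From HB Require Import structures.
From mathcomp Require Import all_boot all_algebra finfield zify ring.
From mathcomp Require Import boolp.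
Require Import Defs.

(* Write R for the p-adic integers.  On a ball a + p^m R, with coordinate u, each delta^i is a
   polynomial in u; modulo p it is the constant delta^i a for i < m, and u + delta^m a for
   i = m.  The map a |-> (delta^i a mod p)_(i < m) is a bijection from Z/p^m to F_p^m, and
   functions on F_p^m are uniquely polynomials of degree at most p - 1 in each variable.
   Hence, modulo p, a family of polynomials in u indexed by the p^m balls comes from exactly
   one polynomial of low degree in x_0, ..., x_m.  Existence follows by lifting this
   successively modulo powers of p.  For uniqueness, two expansions in powers of p are compared
   digit by digit, using that a restricted power series in u vanishing at all u is zero. *)

Set Implicit Arguments.
Unset Strict Implicit.
Unset Printing Implicit Defensive.

Import GRing.Theory.
Local Open Scope ring_scope.

(** * Ring laws for digit sequences, verified on residues modulo powers of [p] *)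

Section Residues.
Variables (p : nat) (pr : prime p).
Implicit Types x y z : Zp p.

Let p_gt0 : (0 < p)%N := prime_gt0 pr.
Let p_gt1 : (1 < p)%N := prime_gt1 pr.
Let pX_gt0 n : (0 < p ^ n)%N. Proof. by rewrite expn_gt0 p_gt0. Qed.

Lemma digit_lt x i : (x i < p)%N.
Proof. by rewrite -[X in (_ < X)%N](prednK p_gt0) ltn_ord. Qed.

Lemma resS x n : res x n.+1 = (res x n + x n * p ^ n)%N.
Proof. by rewrite /res big_ord_recr. Qed.

Lemma res_recl x n : res x n.+1 = (x 0 + p * res (divpZ x) n)%N.
Proof.
rewrite /res big_ord_recl expn0 muln1 big_distrr /=; congr addn.
by apply: eq_bigr => i _; rewrite /divpZ expnS mulnCA.
Qed.

Lemma res_lt x n : (res x n < p ^ n)%N.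
Proof.
elim: n => [|n IH]; first by rewrite /res big_ord0.
by rewrite resS expnS; have := digit_lt x n; nia.
Qed.

Lemma res_modS x n : res x n.+1 = res x n %[mod p ^ n].
Proof. by rewrite resS addnC modnMDl. Qed.

Lemma res_inj x y : (forall n, res x n = res y n) -> x = y.
Proof.
move=> e; apply: funext => i; apply: val_inj => /=.
have := e i.+1; rewrite !resS e => /eqP.
by rewrite eqn_add2l eqn_pmul2r // => /eqP.
Qed.

(** Compatibility of [r] makes the digit read off from [r k.+1] extend the residue of [r k] by one
    place. Every ring operation is computed through this. *)
Lemma res_of_res (r : nat -> nat) n :
  (forall k, r k.+1 = r k %[mod p ^ k]) -> res (of_res p r) n = (r n %% p ^ n)%N.
Proof.
move=> hr; elim: n => [|n IH]; first by rewrite /res big_ord0 expn0 modn1.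
rewrite resS IH /of_res inordK; last by rewrite prednK // ltn_mod.
rewrite -hr [RHS](divn_eq _ (p ^ n)) addnC modn_dvdm ?dvdn_exp2l // expnS.
by rewrite -modn_divl.
Qed.

Lemma res_add x y n : res (addZ x y) n = ((res x n + res y n) %% p ^ n)%N.
Proof.
apply: (@res_of_res (fun n => res x n + res y n)%N) => k.
by rewrite -modnDm !res_modS modnDm.
Qed.

Lemma res_mul x y n : res (mulZ x y) n = ((res x n * res y n) %% p ^ n)%N.
Proof.
apply: (@res_of_res (fun n => res x n * res y n)%N) => k.
by rewrite -modnMm !res_modS modnMm.
Qed.

Lemma res_opp x n : res (oppZ x) n = ((p ^ n - res x n) %% p ^ n)%N.
Proof.
apply: (@res_of_res (fun n => p ^ n - res x n)%N) => k.
apply/eqP; rewrite -(eqn_modDr (res x k)) subnK; last exact/ltnW/res_lt.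
rewrite -modnDmr -res_modS modnDmr subnK; last exact/ltnW/res_lt.
by rewrite expnS modnMl modnn.
Qed.

Lemma res_zero n : res (zeroZ p) n = 0%N.
Proof. by rewrite /res big1 // => i _; rewrite /zeroZ inordK. Qed.

Lemma res_nat k n : res (natZ p k) n = (k %% p ^ n)%N.
Proof. exact: res_of_res. Qed.

Lemma addZA : associative (@addZ p).
Proof.
move=> x y z; apply: res_inj => n; rewrite !res_add.
by rewrite modnDmr modnDml addnA.
Qed.

Lemma addZC : commutative (@addZ p).
Proof. by move=> x y; apply: res_inj => n; rewrite !res_add addnC. Qed.

Lemma add0Z : left_id (zeroZ p) (@addZ p).
Proof.
by move=> x; apply: res_inj => n; rewrite res_add res_zero modn_small ?res_lt.
Qed.

Lemma addNZ : left_inverse (zeroZ p) (@oppZ p) (@addZ p).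
Proof.
move=> x; apply: res_inj => n; rewrite res_add res_zero res_opp modnDml.
by rewrite subnK ?modnn //; exact/ltnW/res_lt.
Qed.

Lemma mulZA : associative (@mulZ p).
Proof.
move=> x y z; apply: res_inj => n; rewrite !res_mul.
by rewrite modnMmr modnMml mulnA.
Qed.

Lemma mulZC : commutative (@mulZ p).
Proof. by move=> x y; apply: res_inj => n; rewrite !res_mul mulnC. Qed.

Lemma mul1Z : left_id (oneZ p) (@mulZ p).
Proof.
move=> x; apply: res_inj => n.
by rewrite res_mul res_nat modnMml mul1n modn_small ?res_lt.
Qed.

Lemma mulZDl : left_distributive (@mulZ p) (@addZ p).
Proof.
move=> x y z; apply: res_inj => n.
by rewrite !(res_mul, res_add) modnMml modnDm mulnDl.
Qed.

End Residues.

(* The primality proof in the type makes the ring structure on [Zp p] inferable. *)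
Definition padic (p : nat) (pr : prime p) : Type := Zp p.

HB.instance Definition _ p (pr : prime p) := gen_eqMixin (padic pr).
HB.instance Definition _ p (pr : prime p) := gen_choiceMixin (padic pr).

Lemma oneZ_neq0 p (pr : prime p) : (oneZ p : padic pr) != (zeroZ p : padic pr).
Proof.
apply/eqP => /(congr1 (fun x : Zp p => res x 1)).
by rewrite res_nat // res_zero // expn1 modn_small // prime_gt1.
Qed.

HB.instance Definition _ p (pr : prime p) := GRing.isZmodule.Build (padic pr)
  (addZA pr) (addZC pr) (add0Z pr) (addNZ pr).
HB.instance Definition _ p (pr : prime p) := GRing.Zmodule_isComNzRing.Build (padic pr)
  (mulZA pr) (mulZC pr) (mul1Z pr) (mulZDl pr) (oneZ_neq0 pr).

(** * The digit shift in terms of the ring structure *)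

Section DigitShift.
Variables (p : nat) (pr : prime p).
Local Notation R := (padic pr).
Implicit Types x y z : R.

Let p_gt0 : (0 < p)%N := prime_gt0 pr.
Let p_gt1 : (1 < p)%N := prime_gt1 pr.

Lemma powZE x k : powZ x k = (x ^+ k : R).
Proof. by elim: k => // k IH; rewrite exprS /powZ iterS -/(powZ x k) IH. Qed.

Lemma subZE x y : subZ x y = (x - y : R). Proof. by []. Qed.

Lemma natZE k : natZ p k = (k%:R : R).
Proof.
elim: k => [|k IH]; first by apply: res_inj => // n; rewrite res_nat // mod0n res_zero.
rewrite -addn1 natrD -IH; apply: res_inj => // n.
by rewrite -[_ + _]/(addZ _ _) res_add // !res_nat // modnDm.
Qed.

Lemma digit0_split x : x = (nat_of_ord (x 0%N))%:R + p%:R * (divpZ x : R).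
Proof.
apply: res_inj => // n; rewrite -!natZE.
rewrite -[_ + _]/(addZ _ _) -[_ * _]/(mulZ _ _) res_add // res_mul // !res_nat //.
(* The residue is raised to level [n.+1], where it is the lowest digit plus [p] times the level [n]
   residue of the shift. *)
rewrite modnDm -[LHS](modn_small (res_lt pr x n)) -res_modS // res_recl.
by apply/eqP; rewrite eqn_modDl modnMml.
Qed.

End DigitShift.

(** * Divisibility in commutative rings, for p-adic integers and polynomials alike *)

Definition dvd (S : comPzRingType) (d x : S) : Prop := exists z, x = d * z.

Section Divisibility.
Variable S : comPzRingType.
Implicit Types d x y : S.

Lemma dvd0 d : dvd d 0. Proof. by exists 0; rewrite mulr0. Qed.

Lemma dvd_mulr d x y : dvd d x -> dvd d (x * y).
Proof. by case=> z ->; exists (z * y); rewrite mulrA. Qed.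

Lemma dvd_add d x y : dvd d x -> dvd d y -> dvd d (x + y).
Proof. by move=> [z ->] [t ->]; exists (z + t); rewrite mulrDr. Qed.

Lemma dvd_opp d x : dvd d x -> dvd d (- x).
Proof. by move=> [z ->]; exists (- z); rewrite mulrN. Qed.

Lemma dvd_sub d x y : dvd d x -> dvd d y -> dvd d (x - y).
Proof. by move=> hx hy; apply: dvd_add hx (dvd_opp hy). Qed.

Lemma dvd_subC d x y : dvd d (x - y) -> dvd d (y - x).
Proof. by move/dvd_opp; rewrite opprB. Qed.

Lemma dvd_trans_sub d x y z : dvd d (x - y) -> dvd d (y - z) -> dvd d (x - z).
Proof. by move=> h1 h2; have := dvd_add h1 h2; rewrite addrA subrK. Qed.

Lemma dvd_sum d (I : Type) (r : seq I) (P : pred I) (F : I -> S) :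
  (forall i, P i -> dvd d (F i)) -> dvd d (\sum_(i <- r | P i) F i).
Proof. by move=> h; elim/big_ind: _ => //; [apply: dvd0 | apply: dvd_add]. Qed.

Lemma dvd_exp_le d x m n : (m <= n)%N -> dvd (d ^+ n) x -> dvd (d ^+ m) x.
Proof.
by move=> le_mn [z ->]; rewrite -(subnKC le_mn) exprD -mulrA; exists (d ^+ (n - m) * z).
Qed.

Lemma dvd_subX d x y n : dvd d (x - y) -> dvd d (x ^+ n - y ^+ n).
Proof. by move=> h; rewrite subrXX; apply: dvd_mulr. Qed.

(** The cofactor of [x - y] is a sum of [n] products, each congruent to [y ^+ n.-1] modulo [n],
    hence is itself divisible by [n]. *)
Lemma subX_natr n x y : dvd n%:R (x - y) ->
  exists2 w, dvd n%:R w & x ^+ n - y ^+ n = (x - y) * w.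
Proof.
move=> h; exists (\sum_(i < n) x ^+ (n.-1 - i) * y ^+ i); last exact: subrXX.
have -> : \sum_(i < n) x ^+ (n.-1 - i) * y ^+ i =
    \sum_(i < n) (x ^+ (n.-1 - i) - y ^+ (n.-1 - i)) * y ^+ i + n%:R * y ^+ n.-1.
  rewrite mulr_natl -[X in _ *+ X](card_ord n) -sumr_const -big_split /=.
  apply: eq_bigr => i _; rewrite mulrBl -exprD subnK ?subrK //.
  by have := ltn_ord i; lia.
apply: dvd_add; last by exists (y ^+ n.-1).
by apply: dvd_sum => i _; apply/dvd_mulr/dvd_subX.
Qed.

End Divisibility.

(** * Reduction modulo [p] and the Fermat quotient *)

Section Reduction.
Variables (p : nat) (pr : prime p).
Local Notation R := (padic pr).
Implicit Types x y z : R.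

Let p_gt0 : (0 < p)%N := prime_gt0 pr.
Let p_gt1 : (1 < p)%N := prime_gt1 pr.

Definition red (x : R) : 'F_p := (nat_of_ord (x 0%N))%:R.

Lemma redE x : red x = (res x 1)%:R.
Proof. by rewrite /red /res big_ord1 expn0 muln1. Qed.

Lemma redD x y : red (x + y) = red x + red y.
Proof.
by rewrite !redE -[x + y]/(addZ x y) res_add // expn1 Fp_nat_mod // natrD.
Qed.

Lemma redM x y : red (x * y) = red x * red y.
Proof.
by rewrite !redE -[x * y]/(mulZ x y) res_mul // expn1 Fp_nat_mod // natrM.
Qed.

Fact red_zmod_morphism : zmod_morphism red.
Proof.
move=> x y; apply/eqP; rewrite -[X in X == _](addrK (red y)) -redD subrK.
by [].
Qed.

Fact red_monoid_morphism : monoid_morphism red.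
Proof.
by split; [rewrite redE res_nat // expn1 Fp_nat_mod | exact: redM].
Qed.

HB.instance Definition _ := GRing.isZmodMorphism.Build R 'F_p red red_zmod_morphism.
HB.instance Definition _ := GRing.isMonoidMorphism.Build R 'F_p red red_monoid_morphism.

Lemma red_p : red p%:R = 0.
Proof. by rewrite rmorph_nat pchar_Fp_0. Qed.

Lemma natr_Fp_inj i j : (i < p)%N -> (j < p)%N -> i%:R = j%:R :> 'F_p -> i = j.
Proof.
move=> hi hj /(congr1 (@nat_of_ord _)); rewrite !val_Fp_nat //.
by rewrite !modn_small.
Qed.

Lemma red_eq0 x : red x = 0 -> x = p%:R * (divpZ x : R).
Proof.
move=> h; rewrite [LHS]digit0_split; have -> : nat_of_ord (x 0%N) = 0%N.
  by apply: natr_Fp_inj; rewrite ?digit_lt.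
by rewrite add0r.
Qed.

Lemma red_eq0_dvd x : red x = 0 <-> dvd p%:R x.
Proof.
split; first by move/red_eq0 => h; exists (divpZ x).
by case=> z ->; rewrite rmorphM /= red_p mul0r.
Qed.

(** The residue of [p * x] at level [n.+1] determines that of [x] at level [n]. *)
Lemma p_mulI : injective (fun x : R => p%:R * x).
Proof.
move=> x y /= e; apply: res_inj => // n.
have := congr1 (fun z : R => res z n.+1) e.
rewrite -!natZE -!/(mulZ _ _) /= !res_mul // !res_nat // !modnMml expnS -!muln_modr.
move/eqP; rewrite eqn_pmul2l // !res_modS // => /eqP.
by rewrite !modn_small ?res_lt.
Qed.

Lemma pX_mulI k : injective (fun x : R => p%:R ^+ k * x).
Proof.
elim: k => [|k IH] x y /=; first by rewrite !expr0 !mul1r.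
by rewrite exprS -!mulrA => /p_mulI/IH.
Qed.

Lemma digit_expansion x E :
  dvd (p%:R ^+ E) (x - \sum_(e < E) p%:R ^+ e * (nat_of_ord (x e))%:R).
Proof.
elim: E x => [|E IH] x; first by rewrite expr0 big_ord0; exists (x - 0); rewrite mul1r.
have [z hz] := IH (divpZ x : R); exists z.
rewrite big_ord_recl expr0 mul1r {1}[x]digit0_split opprD addrACA subrr add0r.
rewrite exprS -mulrA -hz mulrBr; congr (_ - _); rewrite mulr_sumr.
by apply: eq_bigr => i _; rewrite exprS mulrA.
Qed.

(** Translates agreement of digits into divisibility, the form of all later estimates. For the
    converse, the lowest digits agree modulo [p]; cancelling [p] leaves the shifts. *)
Lemma eqmodZP k x y : eqmodZ k x y <-> dvd (p%:R ^+ k) (x - y).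
Proof.
split=> [h|].
  apply: (dvd_trans_sub (digit_expansion x k)); apply: dvd_subC.
  rewrite (eq_bigr (fun e : 'I_k => p%:R ^+ e * (nat_of_ord (y e))%:R)) => [|i _].
    exact: digit_expansion.
  by rewrite h.
elim: k x y => [|k IH] x y // [z hz].
have e0 : x 0%N = y 0%N.
  apply: val_inj; apply: natr_Fp_inj; rewrite ?digit_lt //.
  apply/eqP; rewrite -subr_eq0 -!/(red _) -rmorphB /= hz exprS -mulrA.
  by apply/eqP/red_eq0_dvd; exists (p%:R ^+ k * z).
have e1 : eqmodZ k (divpZ x) (divpZ y).
  apply: (IH (divpZ x) (divpZ y)); exists z; apply: p_mulI => /=.
  rewrite mulrA -exprS -hz {2}[x]digit0_split {2}[y]digit0_split e0.
  by rewrite opprD addrACA subrr add0r mulrBr.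
by case=> // i hi; apply: e1.
Qed.

Definition deltaR (a : R) : R := delta a.

(** By Fermat's little theorem [a - a ^+ p] reduces to zero, so the digit shift is an exact
    division. *)
Lemma deltaE (a : R) : p%:R * deltaR a = a - a ^+ p.
Proof.
rewrite /deltaR /delta powZE subZE -red_eq0 // rmorphB rmorphXn /=.
by rewrite -[X in _ ^+ X](card_Fp pr) expf_card subrr.
Qed.

(** Bootstrapping: [a - b] is [(a - b) * w], with [p] dividing [w], plus [p] times the difference of
    the quotients. Each known power of [p] in [a - b] thus yields one more, up to [k.+1]. *)
Lemma dvd_delta (a b : R) k : red a = red b ->
  dvd (p%:R ^+ k) (deltaR a - deltaR b) -> dvd (p%:R ^+ k.+1) (a - b).
Proof.
move=> e h.
have h1 : dvd p%:R (a - b) by apply/red_eq0_dvd; rewrite rmorphB /= e subrr.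
have [w hw aw] := subX_natr h1.
have ab : a - b = (a - b) * w + p%:R * (deltaR a - deltaR b).
  by rewrite -aw mulrBr !deltaE; ring.
suff hj j : (j <= k)%N -> dvd (p%:R ^+ j.+1) (a - b) by apply: hj.
elim: j => [|j IH] hj; first by rewrite expr1.
rewrite ab; apply: dvd_add.
  case: hw (IH (ltnW hj)) => w' -> [v ->]; exists (v * w').
  by rewrite [in RHS]exprSr; ring.
have [z ->] := dvd_exp_le hj h; exists z.
by rewrite mulrA -exprS.
Qed.

(** The induction is applied to [deltaR a] and [deltaR b]; [dvd_delta] then gains the last power of
    [p]. *)
Lemma delta_residues_inj m (a b : R) :
  (forall i, (i < m)%N -> red (iter i deltaR a) = red (iter i deltaR b)) ->
  dvd (p%:R ^+ m) (a - b).
Proof.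
elim: m a b => [|m IH] a b h; first by rewrite expr0; exists (a - b); rewrite mul1r.
apply: dvd_delta; first exact: (h 0%N).
by apply: IH => i hi; rewrite -!iterSr; apply: h.
Qed.

Lemma eqmodZ_res k x y : eqmodZ k x y -> res x k = res y k.
Proof. by move=> h; apply: eq_bigr => i _; rewrite h. Qed.

Lemma dvd_sub_res x k : dvd (p%:R ^+ k) (x - (res x k)%:R).
Proof.
suff -> : (res x k)%:R = \sum_(e < k) p%:R ^+ e * (nat_of_ord (x e))%:R :> R.
  exact: digit_expansion.
by rewrite /res natr_sum; apply: eq_bigr => e _; rewrite natrM natrX mulrC.
Qed.

Section Polynomials.
Implicit Types P Q : {poly R}.
Local Notation redp := (map_poly red).

Lemma redp_eq0 P : redp P = 0 <-> dvd p%:R P.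
Proof.
split=> [h|[Q ->]]; last by rewrite rmorphM rmorph_nat /= -polyC_natr pchar_Fp_0 // mul0r.
exists (\poly_(i < size P) (divpZ P`_i : R)); apply/polyP => i.
rewrite mulr_natl coefMn coef_poly; case: ltnP => hi; last by rewrite mul0rn nth_default.
by rewrite -mulr_natl -red_eq0 // -coef_map h coef0.
Qed.

Lemma dvd_polyP d P : dvd (p%:R ^+ d) P <-> forall i, dvd (p%:R ^+ d) P`_i.
Proof.
split=> [[Q ->] i|h];
  first by exists Q`_i; rewrite -[in LHS]natrX mulr_natl coefMn -natrX mulr_natl.
have [g hg] := choice h.
exists (\poly_(i < size P) g i); apply/polyP => i.
rewrite -natrX mulr_natl coefMn coef_poly; case: ltnP => hi.
  by rewrite hg -natrX mulr_natl.
by rewrite mul0rn nth_default.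
Qed.

Lemma redp_surj (P : {poly 'F_p}) : exists Q, redp Q = P.
Proof.
exists (\poly_(i < size P) (nat_of_ord P`_i)%:R); apply/polyP => i.
rewrite coef_map coef_poly /=; case: ltnP => hi; first by rewrite rmorph_nat natr_Zp.
by rewrite rmorph0 nth_default.
Qed.

End Polynomials.

End Reduction.

(** * Polynomial interpolation on a power of a finite field *)

Section Interpolation.
Variables (K : finFieldType) (N : nat).
(** A separate name for the cardinality lets exponents live in ['I_p] when [K] is ['F_p]. *)
Hypothesis cardK : #|K| = N.

Let N_gt1 : (1 < N)%N. Proof. by rewrite -cardK finNzRing_gt1. Qed.

(* Fermat: the indicator polynomial of [s]. *)
Definition indicator_poly (s : K) : {poly K} := 1 - ('X - s%:P) ^+ N.-1.

Lemma size_indicator_poly s : (size (indicator_poly s) <= N)%N.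
Proof.
rewrite /indicator_poly (leq_trans (size_polyD _ _)) // geq_max size_polyN size_poly1.
rewrite size_exp_XsubC prednK; last exact: ltnW.
by rewrite leqnn ltnW.
Qed.

Lemma indicator_polyE s t : (indicator_poly s).[t] = (s == t)%:R.
Proof.
rewrite /indicator_poly !hornerE; have [->|neq] := eqVneq s t.
  by rewrite subrr expr0n -(subnKC N_gt1) subr0.
have nz : t - s != 0 by rewrite subr_eq0 eq_sym.
suff -> : (t - s) ^+ N.-1 = 1 by rewrite subrr.
apply: (mulfI nz); rewrite -exprS prednK; last exact: ltnW.
by rewrite mulr1 -cardK expf_card.
Qed.

Lemma sum_indicator_coef s t :
  \sum_(j < N) (indicator_poly s)`_j * t ^+ j = (s == t)%:R.
Proof. by rewrite -indicator_polyE (horner_coef_wide t (size_indicator_poly s)). Qed.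

(* Inverse on the other side of the Vandermonde matrix: [\sum_s s ^+ j *: indicator_poly s]
   and ['X^j] have degree less than [#|K|] and the same values on [K]. *)
Lemma sum_indicator_coef_dual (i j : 'I_N) :
  \sum_s (indicator_poly s)`_i * s ^+ j = (i == j)%:R.
Proof.
have -> : \sum_s (indicator_poly s)`_i * s ^+ j = (\sum_s s ^+ j *: indicator_poly s)`_i.
  by rewrite coef_sum; apply: eq_bigr => s _; rewrite coefZ mulrC.
suff -> : \sum_s s ^+ j *: indicator_poly s = 'X^j by rewrite coefXn.
apply/eqP; rewrite -subr_eq0; apply/negP => /negP nz.
have sz : (size (\sum_s s ^+ j *: indicator_poly s - 'X^j)%R <= N)%N.
  rewrite (leq_trans (size_polyD _ _)) // geq_max size_polyN size_polyXn ltn_ord andbT.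
  rewrite (leq_trans (size_sum _ _ _)) //; apply/bigmax_leqP => s _.
  by apply: leq_trans (size_indicator_poly s); apply: size_scale_leq.
have rt : all (root (\sum_s s ^+ j *: indicator_poly s - 'X^j)) (enum K).
  apply/allP => t _; rewrite rootE hornerD hornerN hornerXn horner_sum (bigD1 t) //= big1.
    by rewrite hornerZ indicator_polyE eqxx mulr1 addr0 subrr.
  by move=> s /negPf neq; rewrite hornerZ indicator_polyE neq mulr0.
have := max_poly_roots nz rt (enum_uniq K).
by rewrite -cardE cardK => /leq_trans/(_ sz); rewrite ltnn.
Qed.

Variables (m : nat) (V : lmodType K).
Local Notation digits := {ffun 'I_m -> 'I_N}.
Local Notation points := {ffun 'I_m -> K}.

(** The ring varies: the arguments will be residues, p-adic integers or polynomials. *)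
Definition monomial (S : pzSemiRingType) (x : 'I_m -> S) (b : digits) : S :=
  \prod_i x i ^+ b i.

(** Lagrange interpolation: the coefficient at [b] of the sum of [g s] times the indicator
    polynomial of [s]. Later [V] consists of polynomials in the last variable. *)
Definition interp_coef (g : points -> V) (b : digits) : V :=
  \sum_(s : points) (\prod_i (indicator_poly (s i))`_(b i)) *: g s.

(** After exchanging sums, the sum over [b] factors over coordinates into indicators, which leave
    only [s = t]. *)
Lemma interp_coefE (g : points -> V) (t : points) :
  \sum_b monomial t b *: interp_coef g b = g t.
Proof.
rewrite /interp_coef; under eq_bigr do rewrite scaler_sumr.
rewrite exchange_big /= (bigD1 t) //= [X in _ + X]big1 => [|s neq].
  rewrite addr0; under eq_bigr do rewrite scalerA -big_split /=.
  rewrite -scaler_suml.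
  rewrite -(bigA_distr_bigA (fun i (j : 'I_N) => t i ^+ j * (indicator_poly (t i))`_j)).
  rewrite big1 ?scale1r // => i _; under eq_bigr do rewrite mulrC.
  by rewrite sum_indicator_coef eqxx.
under eq_bigr do rewrite scalerA -big_split /=.
rewrite -scaler_suml -(bigA_distr_bigA (fun i (j : 'I_N) => t i ^+ j * (indicator_poly (s i))`_j)).
have [i nei] : exists i, s i != t i.
  apply/existsP; rewrite -negb_forall; apply: contra neq => /forallP h.
  by apply/eqP/ffunP => i; apply/eqP.
rewrite (bigD1 i) //=; under eq_bigr do rewrite mulrC.
by rewrite sum_indicator_coef (negPf nei) mul0r scale0r.
Qed.

(** Interpolating the zero values returns [c b]: the sum over points factors over coordinates, and
    [sum_indicator_coef_dual] kills every other exponent. *)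
Lemma interp_coef_inj (c : digits -> V) :
  (forall t : points, \sum_b monomial t b *: c b = 0) -> forall b, c b = 0.
Proof.
move=> h b.
have : \sum_(s : points) (\prod_i (indicator_poly (s i))`_(b i)) *:
    (\sum_b' monomial s b' *: c b') = 0.
  by rewrite big1 // => s _; rewrite h scaler0.
under eq_bigr do rewrite scaler_sumr.
rewrite exchange_big /= (bigD1 b) //= [X in _ + X]big1 => [|b' neq].
  rewrite addr0; under eq_bigr do rewrite scalerA -big_split /=.
  rewrite -scaler_suml -(bigA_distr_bigA (fun i s => (indicator_poly s)`_(b i) * s ^+ b i)).
  by rewrite big1 ?scale1r // => i _; rewrite sum_indicator_coef_dual eqxx.
under eq_bigr do rewrite scalerA -big_split /=.
rewrite -scaler_suml -(bigA_distr_bigA (fun i s => (indicator_poly s)`_(b i) * s ^+ b' i)).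
have [i nei] : exists i, b i != b' i.
  apply/existsP; rewrite -negb_forall; apply: contra neq => /forallP e.
  by apply/eqP/ffunP => i; apply/esym/eqP.
by rewrite (bigD1 i) //= sum_indicator_coef_dual (negPf nei) mul0r scale0r.
Qed.

End Interpolation.

Lemma horner_natr (S : nzRingType) n (u : S) : (n%:R : {poly S}).[u] = n%:R.
Proof. by rewrite hornerMn hornerC. Qed.

(** * Low-degree polynomials in the iterates of [deltaR], restricted to balls *)

Section Pullback.
Variables (p : nat) (pr : prime p) (m : nat).
Local Notation R := (padic pr).
Local Notation redp := (map_poly (@red p pr)).
Local Notation digits := {ffun 'I_m -> 'I_p}.
Local Notation points := {ffun 'I_m -> 'F_p}.
Implicit Types a u x : R.

Let p_gt0 : (0 < p)%N := prime_gt0 pr.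
Let p_gt1 : (1 < p)%N := prime_gt1 pr.

Definition residues a : points := [ffun i : 'I_m => red (iter i (@deltaR p pr) a)].

(** Injectivity suffices, since both sides have [p ^ m] elements. *)
Lemma residues_bij : bijective (fun n : 'I_(p ^ m) => residues n%:R).
Proof.
apply: inj_card_bij => [i j /ffunP h|]; last by rewrite card_ffun card_Fp // !card_ord.
apply: val_inj => /=.
have : dvd (p%:R ^+ m) (i%:R - j%:R : R).
  by apply: delta_residues_inj => k hk; have := h (Ordinal hk); rewrite !ffunE.
move/eqmodZP/eqmodZ_res; rewrite -!natZE !res_nat //.
by rewrite !modn_small.
Qed.

(* [\delta (a + p ^ k.+1 y) = \delta a + p ^ k (y - p y w)]: the leading term of [y] survives. *)
Lemma delta_curve a k (Y : {poly R}) : redp Y = 'X ->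
  exists2 Y' : {poly R}, redp Y' = 'X &
    forall u, deltaR (a + p%:R ^+ k.+1 * Y.[u]) = deltaR a + p%:R ^+ k * Y'.[u].
Proof.
move=> hY; pose T := p%:R ^+ k.+1 * Y.
have hT : dvd p%:R (a%:P + T - a%:P).
  by rewrite addrC addKr /T exprS -mulrA; exists (p%:R ^+ k * Y).
have [w [W ->]] := subX_natr hT; rewrite [_ + T - _]addrC addKr => e.
exists (Y - p%:R * (Y * W)).
  rewrite rmorphB /= hY (_ : redp _ = 0) ?subr0 //.
  by apply/redp_eq0; exists (Y * W).
move=> u; apply: (@p_mulI p pr) => /=.
have := congr1 (fun P : {poly R} => P.[u]) e; rewrite /T /=.
rewrite !(hornerD, hornerN, hornerM, horner_exp, horner_natr, hornerC) => {}e.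
rewrite mulrDr !deltaE; move/eqP: e; rewrite subr_eq => /eqP ->.
by rewrite exprS; ring.
Qed.

(** Each application of [deltaR] costs one factor [p], so the initial [p ^ m] allows [m] of them. *)
Lemma iter_delta_curve a i : (i <= m)%N ->
  exists2 Y : {poly R}, redp Y = 'X &
    forall u, iter i (@deltaR p pr) (a + p%:R ^+ m * u) =
              iter i (@deltaR p pr) a + p%:R ^+ (m - i) * Y.[u].
Proof.
elim: i => [|i IH] hi.
  by exists 'X; [rewrite map_polyX | move=> u; rewrite hornerX subn0].
have [Y hY e] := IH (ltnW hi).
have [Y' hY' e'] := delta_curve (iter i (@deltaR p pr) a) (m - i.+1) hY.
exists Y' => // u; rewrite iterS e -e' /=.
by rewrite -subSn // subSS.
Qed.

(* [X i] is [\delta^i] restricted to the ball [a + p ^ m R], as a polynomial in the ball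
   coordinate. *)
Definition curve_spec a (X : nat -> {poly R}) : Prop :=
  [/\ forall i, (i <= m)%N -> forall u,
        (X i).[u] = iter i (@deltaR p pr) (a + p%:R ^+ m * u),
      forall i, (i < m)%N -> redp (X i) = (red (iter i (@deltaR p pr) a))%:P
    & redp (X m) = 'X + (red (iter m (@deltaR p pr) a))%:P].

(** For [i < m] a factor [p] remains before the variable part, which dies modulo [p]; at [i = m]
    none remains and the variable survives. *)
Lemma curve_exists a : exists X, curve_spec a X.
Proof.
have /choice[X hX] (i : nat) : exists P : {poly R}, (i <= m)%N ->
    [/\ forall u, P.[u] = iter i (@deltaR p pr) (a + p%:R ^+ m * u),
        (i < m)%N -> redp P = (red (iter i (@deltaR p pr) a))%:P
      & i = m -> redp P = 'X + (red (iter m (@deltaR p pr) a))%:P].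
  (* Beyond [m] nothing is required, and zero is a default value for the choice. *)
  case: (leqP i m) => [hi|_]; last by exists 0.
  have [Y hY e] := iter_delta_curve a hi.
  exists ((iter i (@deltaR p pr) a)%:P + p%:R ^+ (m - i) * Y) => _; split.
  - by move=> u; rewrite e hornerD hornerC hornerM horner_exp horner_natr.
  - move=> lt_im; rewrite rmorphD /= map_polyC /= (_ : redp _ = 0) ?addr0 //.
    by apply/redp_eq0; rewrite -(subnSK lt_im) exprS -mulrA; exists (p%:R ^+ (m - i.+1) * Y).
  - by move=> ->; rewrite subnn expr0 mul1r rmorphD /= map_polyC hY addrC.
exists X; split => [i hi|i hi|]; first by case: (hX i hi).
  by case: (hX i (ltnW hi)) => _ h _; apply: h.
by case: (hX m (leqnn m)) => _ _; apply.
Qed.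

(** Here [c b], a polynomial in the last variable, is the coefficient of the monomial [b] in the
    first [m] variables; [pull] substitutes a curve, [low_eval] a point. *)
Definition pull (X : nat -> {poly R}) (c : digits -> {poly R}) : {poly R} :=
  \sum_b monomial (fun i : 'I_m => X i) b * (c b \Po X m).

Definition low_eval (x : nat -> R) (c : digits -> {poly R}) : R :=
  \sum_b monomial (fun i : 'I_m => x i) b * (c b).[x m].

Lemma horner_pull a X c u : curve_spec a X ->
  (pull X c).[u] = low_eval (fun i => iter i (@deltaR p pr) (a + p%:R ^+ m * u)) c.
Proof.
case=> hX _ _; rewrite /pull horner_sum; apply: eq_bigr => b _.
rewrite hornerM horner_comp hX // /monomial horner_prod; congr (_ * _).
by apply: eq_bigr => i _; rewrite horner_exp hX // ltnW.
Qed.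

(** Modulo [p] the first [m] coordinates are constants and the last is a translation, which reduces
    the problem on a ball to evaluation at one point of [points]. *)
Lemma red_pull a X c : curve_spec a X ->
  redp (pull X c) =
  (\sum_b monomial (residues a) b *: redp (c b))
    \Po ('X + (red (iter m (@deltaR p pr) a))%:P).
Proof.
case=> _ hX hXm; rewrite /pull !raddf_sum /=; apply: eq_bigr => b _.
rewrite rmorphM /= map_comp_poly hXm comp_polyZ -mul_polyC; congr (_ * _).
rewrite /monomial !rmorph_prod; apply: eq_bigr => i _.
by rewrite !rmorphXn /= hX // ffunE.
Qed.

Lemma comp_XaddK (S : comNzRingType) (P : {poly S}) c :
  (P \Po ('X - c%:P)) \Po ('X + c%:P) = P.
Proof. by rewrite -comp_polyA comp_polyB comp_polyX comp_polyC addrK comp_polyXr. Qed.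

Lemma comp_XsubK (S : comNzRingType) (P : {poly S}) c :
  (P \Po ('X + c%:P)) \Po ('X - c%:P) = P.
Proof. by rewrite -comp_polyA comp_polyD comp_polyX comp_polyC subrK comp_polyXr. Qed.

Section Curves.
Variable X : 'I_(p ^ m) -> nat -> {poly R}.
Hypothesis hX : forall n : 'I_(p ^ m), curve_spec n%:R (X n).

(** The translation is undone on each ball, the results are interpolated through [residues_bij], and
    the coefficients are lifted. The pair keeps the remainder for the next order. *)
Lemma pull_surj_mod_p (g : 'I_(p ^ m) -> {poly R}) :
  exists ch : (digits -> {poly R}) * ('I_(p ^ m) -> {poly R}),
    forall n, g n = pull (X n) ch.1 + p%:R * ch.2 n.
Proof.
have [tau sigmaK tauK] := residues_bij.
pose d (n : 'I_(p ^ m)) : 'F_p := red (iter m (@deltaR p pr) (nat_of_ord n)%:R).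
pose G t := redp (g (tau t)) \Po ('X - (d (tau t))%:P).
have /choice[c hc] (b : digits) : exists Q : {poly R}, redp Q = interp_coef G b by apply: redp_surj.
have /choice[h hh] (n : 'I_(p ^ m)) : exists h : {poly R}, g n - pull (X n) c = p%:R * h.
  apply/redp_eq0; rewrite rmorphB /= (red_pull _ (hX n)).
  under eq_bigr do rewrite hc.
  by rewrite (interp_coefE (card_Fp pr)) /G sigmaK comp_XaddK subrr.
by exists (c, h) => n /=; rewrite -hh addrC subrK.
Qed.

(** Undoing the translations shows that the reduced polynomial vanishes at every point, as
    [interp_coef_inj] requires. *)
Lemma pull_inj_mod_p (c : digits -> {poly R}) :
  (forall n, dvd p%:R (pull (X n) c)) -> forall b, dvd p%:R (c b).
Proof.
move=> h b; apply/redp_eq0; move: b; apply: (interp_coef_inj (card_Fp pr)) => t.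
have [tau sigmaK tauK] := residues_bij.
have /redp_eq0 := h (tau t); rewrite (red_pull _ (hX _)) tauK.
move/(congr1 (fun P : {poly 'F_p} => P \Po ('X - (red (iter m (@deltaR p pr) (tau t)%:R))%:P))).
by rewrite comp_XsubK comp_poly0.
Qed.

End Curves.

End Pullback.

(** * Expansions in powers of [p] *)

Lemma dvd_expansion_le (S : comPzRingType) (d : S) (q : nat -> S) M E :
  (M <= E)%N -> dvd (d ^+ M) (\sum_(e < E) d ^+ e * q e - \sum_(e < M) d ^+ e * q e).
Proof.
move/subnKC <-; elim: (E - M)%N => [|k IH]; first by rewrite addn0 subrr; apply: dvd0.
rewrite addnS big_ord_recr /= addrAC; apply: dvd_add IH _.
by rewrite exprD -mulrA; exists (d ^+ k * q (M + k)%N).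
Qed.

Lemma dvd_horner_trunc (S : comNzRingType) (P : {poly S}) (t : S) j :
  dvd (t ^+ j) (P.[t] - \sum_(i < j) P`_i * t ^+ i).
Proof.
rewrite (@horner_coef_wide _ (j + size P)) ?leq_addl // big_split_ord /= addrAC subrr add0r.
apply: dvd_sum => i _; rewrite exprD mulrCA; exists (P`_(j + i) * t ^+ i).
by [].
Qed.

Section Expansions.
Variables (p : nat) (pr : prime p).
Local Notation R := (padic pr).

(** The residues of [s n] modulo [p ^ n] are compatible, and define the limit. *)
Lemma padic_limit (s : nat -> R) : (forall E, dvd (p%:R ^+ E) (s E.+1 - s E)) ->
  exists L : R, forall E, dvd (p%:R ^+ E) (L - s E).
Proof.
move=> h; exists (of_res p (fun n => res (s n) n)) => E.
have e : res (of_res p (fun n => res (s n) n)) E = res (s E) E.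
  rewrite (res_of_res pr) ?modn_small ?res_lt // => k.
  by rewrite res_modS //; congr (_ %% _)%N; apply/eqmodZ_res/eqmodZP.
apply: (dvd_trans_sub (dvd_sub_res _ E)); apply: dvd_subC.
by rewrite e; apply: dvd_sub_res.
Qed.

(* The coefficients are recovered one at a time by evaluating at high powers of [p]. *)
Lemma expansion_identity (q : nat -> {poly R}) :
  (forall E u, dvd (p%:R ^+ E) (\sum_(e < E) p%:R ^+ e * (q e).[u])) -> dvd p%:R (q 0%N).
Proof.
move=> h; pose S E : {poly R} := \sum_(e < E) p%:R ^+ e * q e.
have hS E u : dvd (p%:R ^+ E) (S E).[u].
  rewrite horner_sum; under eq_bigr do rewrite hornerM horner_exp horner_natr.
  exact: h.
suff hj j N : dvd (p%:R ^+ N) (S N)`_j.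
  rewrite -[p%:R]expr1; apply/dvd_polyP => j; have := hj j 1%N.
  by rewrite /S big_ord1 expr0 mul1r.
(* At [p ^ N], the value of [S E], its terms of degree above [j] and, by induction, those below [j]
   are divisible by [p ^ E]. Cancelling [p ^ (N * j)] in the remaining term leaves exactly
   [p ^ N]. *)
elim/ltn_ind: j N => j IH N; pose E := (N * j.+1)%N.
have le_NE : (N <= E)%N by rewrite leq_pmulr.
have hjE : dvd (p%:R ^+ E) ((S E)`_j * (p%:R ^+ N) ^+ j).
  have := dvd_horner_trunc (S E) (p%:R ^+ N) j.+1.
  rewrite -exprM -/E big_ord_recr /= => h1.
  have h2 : dvd (p%:R ^+ E) (\sum_(i < j) (S E)`_i * (p%:R ^+ N) ^+ i : R).
    by apply: dvd_sum => i _; apply/dvd_mulr/IH.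
  have := dvd_sub (dvd_sub (hS E (p%:R ^+ N)) h1) h2.
  by congr dvd; ring.
have {hjE} hjE : dvd (p%:R ^+ N) (S E)`_j.
  have [z] := hjE; rewrite -exprM mulrC /E mulnS addnC exprD -mulrA => /pX_mulI ->.
  by exists z.
have := dvd_expansion_le p%:R q le_NE; rewrite -/(S E) -/(S N) => /dvd_polyP/(_ j).
by rewrite coefB => h1; have := dvd_sub hjE h1; rewrite subKr.
Qed.

Variables (m : nat) (X : 'I_(p ^ m) -> nat -> {poly R}).
Local Notation digits := {ffun 'I_m -> 'I_p}.
Hypothesis hX : forall n : 'I_(p ^ m), curve_spec m n%:R (X n).

Lemma expansion_pull (q : 'I_(p ^ m) -> nat -> {poly R}) :
  exists c : nat -> digits -> {poly R}, forall n E,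
    dvd (p%:R ^+ E) (\sum_(e < E) p%:R ^+ e * q n e - \sum_(e < E) p%:R ^+ e * pull (X n) (c e)).
Proof.
have /choice[s hs] := pull_surj_mod_p hX.
(* [G e] is what must be matched at order [e]: the given term plus the remainder carried from the
   previous order. *)
pose G := fix G e n := if e is e'.+1 then q n e + (s (G e')).2 n else q n 0%N.
exists (fun e => (s (G e)).1) => n E.
(* The left sum runs one order further, because [G E n] already contains [q n E]. *)
have e1 : \sum_(e < E.+1) p%:R ^+ e * q n e =
    \sum_(e < E) p%:R ^+ e * pull (X n) (s (G e)).1 + p%:R ^+ E * G E n.
  elim: E => [|E IH]; first by rewrite big_ord_recr !big_ord0.
  by rewrite big_ord_recr IH [in RHS]big_ord_recr /= (hs (G E) n) exprS; ring.
move: e1; rewrite big_ord_recr /= => /eqP; rewrite eq_sym -subr_eq => /eqP <-.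
exists (G E n - q n E); ring.
Qed.

(** The first hypothesis turns vanishing modulo [p] of the leading term into vanishing; dividing by
    [p] then shifts the sequence. Differences of digits satisfy it. *)
Lemma expansion_unique (d : nat -> digits -> {poly R}) :
  (forall e b i, dvd p%:R (d e b)`_i -> (d e b)`_i = 0) ->
  (forall n E u, dvd (p%:R ^+ E) (\sum_(e < E) p%:R ^+ e * (pull (X n) (d e)).[u])) ->
  forall e b, d e b = 0.
Proof.
have head (d' : nat -> digits -> {poly R}) :
    (forall e b i, dvd p%:R (d' e b)`_i -> (d' e b)`_i = 0) ->
    (forall n E u, dvd (p%:R ^+ E) (\sum_(e < E) p%:R ^+ e * (pull (X n) (d' e)).[u])) ->
    forall b, d' 0%N b = 0.
  move=> hd h b; apply/polyP => i; rewrite coef0; apply: hd.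
  rewrite -[p%:R]expr1; move: i; apply/dvd_polyP; rewrite expr1; move: b.
  apply: (pull_inj_mod_p hX) => n.
  exact: expansion_identity (fun e => pull (X n) (d' e)) (h n).
move=> hd h e; elim: e d hd h => [|e IH] d hd h; first exact: head.
have d0 := head d hd h.
apply: (IH (fun e => d e.+1)) => [e'|n E u]; first exact: hd.
have [z] := h n E.+1 u; rewrite big_ord_recl /= {1}/pull.
rewrite big1 => [|b _]; last by rewrite d0 comp_poly0 mulr0.
rewrite horner0 mulr0 add0r exprS -mulrA; under eq_bigr do rewrite exprS -mulrA.
by rewrite -mulr_sumr => /p_mulI ->; exists z.
Qed.

End Expansions.

(** * Power series of low degree and their expansions in powers of [p] *)

Section Series.
Variables (p : nat) (pr : prime p) (m : nat).
Local Notation R := (padic pr).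
Local Notation digits := {ffun 'I_m -> 'I_p}.
Implicit Types (F : pseries p m.+1) (al : mindex m.+1).

Let p_gt0 : (0 < p)%N := prime_gt0 pr.

Definition mindex_of (b : digits) (n : nat) : mindex m.+1 :=
  [ffun i => if unlift ord_max i is Some j then nat_of_ord (b j) else n].

(** The remainder modulo [p] only serves to land in ['I_p]; it fixes the exponents of a low
    multi-index. *)
Definition low_part al : digits :=
  [ffun j => Ordinal (ltn_pmod (al (lift ord_max j)) p_gt0)].

Definition low al := [forall j : 'I_m, (al (lift ord_max j) < p)%N].

Lemma mindex_ofK al : low al -> mindex_of (low_part al) (al ord_max) = al.
Proof.
move/forallP=> h; apply/ffunP => i; rewrite ffunE.
by case: unliftP => [j ->|-> //]; rewrite ffunE /= modn_small.
Qed.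

Lemma low_mindex_of b n : low (mindex_of b n).
Proof. by apply/forallP => j; rewrite ffunE liftK. Qed.

Lemma mindex_of_max b n : mindex_of b n ord_max = n.
Proof. by rewrite ffunE unlift_none. Qed.

Lemma low_part_mindex_of b n : low_part (mindex_of b n) = b.
Proof.
by apply/ffunP => j; rewrite ffunE; apply: val_inj; rewrite /= ffunE liftK modn_small.
Qed.

Lemma low_degreeP F : low_degree F <-> forall al, ~~ low al -> F al = zeroZ p.
Proof.
split=> [h al|h al [i /andP[lt_im le_p]]].
  rewrite negb_forall => /existsP[j]; rewrite -leqNgt => hj; apply: h.
  by exists (lift ord_max j); rewrite lift_max ltn_ord.
apply: h; rewrite negb_forall; apply/existsP.
case: (unliftP ord_max i) lt_im le_p => [j ->|->] /=; last by rewrite ltnn.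
by move=> _ hj; exists j; rewrite -leqNgt.
Qed.

Lemma mdeg_mindex_of b n : (n <= mdeg (mindex_of b n))%N.
Proof. by rewrite /mdeg (bigD1 ord_max) //= mindex_of_max leq_addr. Qed.

Lemma monomE k (x : 'I_k -> R) (al : mindex k) :
  monom x al = \prod_(i < k) x i ^+ al i :> R.
Proof.
rewrite -[RHS]big_enum /= /monom; elim: (enum 'I_k) => [|i s IH].
  by rewrite big_nil.
by rewrite big_cons /= IH powZE.
Qed.

Lemma psumE k (F : pseries p k) (x : 'I_k -> R) N :
  psum F x N = \sum_(b : {ffun 'I_k -> 'I_N.+1})
    (F (box_index b) : R) * \prod_i x i ^+ box_index b i :> R.
Proof.
rewrite -[RHS]big_enum /= /psum; elim: (enum _) => [|b s IH].
  by rewrite big_nil.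
by rewrite big_cons /= IH monomE.
Qed.

(** Once the box contains all exponents below [p], its low multi-indices form a product of [digits]
    with the range of the last exponent. *)
Lemma sum_box_low N (G : mindex m.+1 -> R) : (p <= N.+1)%N ->
  (forall al, ~~ low al -> G al = 0) ->
  \sum_(b : {ffun 'I_m.+1 -> 'I_N.+1}) G (box_index b) =
  \sum_(b : digits) \sum_(n < N.+1) G (mindex_of b n).
Proof.
move=> le_pN hG; rewrite pair_big /= (bigID (fun b => low (box_index b))) /=.
rewrite [X in _ + X]big1 => [|b /hG //]; rewrite addr0.
pose h (bn : digits * 'I_N.+1) : {ffun 'I_m.+1 -> 'I_N.+1} :=
  [ffun i => inord (mindex_of bn.1 bn.2 i)].
pose h' (b : {ffun 'I_m.+1 -> 'I_N.+1}) : digits * 'I_N.+1 :=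
  (low_part (box_index b), b ord_max).
have hK bn : box_index (h bn) = mindex_of bn.1 bn.2.
  apply/ffunP => i; rewrite !ffunE inordK //.
  by case: unliftP => [j _|_] //; apply: leq_trans le_pN.
have h'K b : low (box_index b) -> h (h' b) = b.
  move=> lb; apply/ffunP => i; apply: val_inj => /=.
  have := congr1 (fun al : mindex m.+1 => al i) (hK (h' b)).
  rewrite [X in X = _ -> _]ffunE => -> /=; have := mindex_ofK lb.
  by rewrite [box_index b ord_max]ffunE => ->; rewrite ffunE.
rewrite (reindex_onto h h' h'K); apply: eq_big => [bn|bn _]; last by rewrite hK.
rewrite hK low_mindex_of; apply/eqP; case: bn => b n; rewrite /h' hK low_part_mindex_of.
congr pair; apply: val_inj; rewrite ffunE /= mindex_of_max inordK //.
Qed.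

(* [F] is the sum of [p ^ e] times the low-degree polynomials with [x^b]-coefficient [c e b]
   in the last variable. *)
Definition expands F (c : nat -> digits -> {poly R}) : Prop :=
  forall E b n, dvd (p%:R ^+ E) ((F (mindex_of b n) : R) - \sum_(e < E) p%:R ^+ e * (c e b)`_n).

Lemma psum_expands F c (x : nat -> R) E : low_degree F -> expands F c ->
  exists N0, forall N, (N0 <= N)%N -> dvd (p%:R ^+ E)
    ((psum F (fun i : 'I_m.+1 => x i) N : R) - \sum_(e < E) p%:R ^+ e * low_eval x (c e)).
Proof.
move=> /low_degreeP hF hc.
(* The box must hold all exponents below [p] and all terms of each [c e b] with [e < E]; the two
   sums are then compared term by term. *)
exists (p + \max_(e < E) \max_(b : digits) size (c e b))%N => N le_N.
have szN (e : 'I_E) b : (size (c e b) <= N.+1)%N.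
  apply: leq_trans (leqW le_N); apply: leq_trans (leq_addl _ _).
  apply: leq_trans (leq_bigmax e); exact: leq_bigmax b.
rewrite psumE (@sum_box_low N (fun al => (F al : R) * \prod_(i < m.+1) x i ^+ al i)); first last.
- by move=> al /hF ->; rewrite mul0r.
- by apply: leq_trans (leqW le_N); apply: leq_addr.
have -> : \sum_(e < E) p%:R ^+ e * low_eval x (c e) =
    \sum_b \sum_(n < N.+1) (\sum_(e < E) p%:R ^+ e * (c e b)`_n) *
      \prod_(i < m.+1) x i ^+ mindex_of b n i.
  rewrite /low_eval; under eq_bigr do rewrite mulr_sumr.
  rewrite exchange_big /=; apply: eq_bigr => b _.
  under [RHS]eq_bigr do rewrite mulr_suml.
  rewrite exchange_big /=; apply: eq_bigr => e _.
  rewrite (horner_coef_wide _ (szN e b)) !mulr_sumr; apply: eq_bigr => n _.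
  have -> : \prod_(i < m.+1) x i ^+ mindex_of b n i =
      monomial (fun i : 'I_m => x i) b * x m ^+ n.
    rewrite big_ord_recr /= mindex_of_max; congr (_ * _); apply: eq_bigr => i _.
    have -> : widen_ord (leqnSn m) i = lift ord_max i.
      by apply: val_inj; rewrite /= /bump leqNgt ltn_ord.
    by rewrite ffunE liftK.
  by rewrite -[RHS]mulrA [X in _ = _ * X]mulrCA.
rewrite -sumrB; apply: dvd_sum => b _; rewrite -sumrB; apply: dvd_sum => n _.
by rewrite -mulrBl; apply/dvd_mulr/hc.
Qed.

(** Partial sums are eventually congruent to the truncated expansion, so convergence becomes a
    family of congruences without [N]. *)
Lemma series_eval_expands F c (x : nat -> R) (L : R) : low_degree F -> expands F c ->
  series_eval F (fun i : 'I_m.+1 => x i) L <->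
  forall E, dvd (p%:R ^+ E) (L - \sum_(e < E) p%:R ^+ e * low_eval x (c e)).
Proof.
move=> hF hc; split=> h E; have [N0 h0] := psum_expands x E hF hc.
  have [N1 h1] := h E.
  have /h0 h2 := leq_maxl N0 N1; have /h1/(@eqmodZP p pr _ _ _) h3 := leq_maxr N0 N1.
  exact: dvd_trans_sub (dvd_subC h3) h2.
exists N0 => N /h0 h2; apply/(@eqmodZP p pr _ _ _).
exact: dvd_trans_sub h2 (dvd_subC (h E)).
Qed.

Lemma digit_expands F : restricted F ->
  exists2 c : nat -> digits -> {poly R}, expands F c &
    forall e b n, (c e b)`_n = (nat_of_ord (F (mindex_of b n) e))%:R.
Proof.
move=> /choice[N hN].
(* Digit [e] is controlled by congruence modulo [p ^ e.+1], whence the bound [N e.+1]. *)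
have hc e b n : (\poly_(i < N e.+1) (nat_of_ord (F (mindex_of b i) e))%:R : {poly R})`_n =
    (nat_of_ord (F (mindex_of b n) e))%:R.
  rewrite coef_poly; case: ltnP => // le_n.
  rewrite (hN e.+1) ?(leq_trans le_n) ?mdeg_mindex_of //.
  by rewrite /zeroZ inordK.
exists (fun e b => \poly_(i < N e.+1) (nat_of_ord (F (mindex_of b i) e))%:R) => // E b n.
under eq_bigr do rewrite hc.
exact: digit_expansion.
Qed.

Lemma series_of_expansion (c : nat -> digits -> {poly R}) :
  exists F, [/\ restricted F, low_degree F & expands F c].
Proof.
pose s b n E : R := \sum_(e < E) p%:R ^+ e * (c e b)`_n.
have /choice[L hL] (bn : digits * nat) : exists L : R,
    forall E, dvd (p%:R ^+ E) (L - s bn.1 bn.2 E).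
  apply: padic_limit => E; rewrite /s big_ord_recr addrAC subrr add0r.
  by exists (c E bn.1)`_bn.2.
pose F al : Zp p := if low al then L (low_part al, al ord_max) else zeroZ p.
have hF : expands F c.
  by move=> E b n; rewrite /F low_mindex_of low_part_mindex_of mindex_of_max; apply: hL.
exists F; split => //; last by apply/low_degreeP => al /negPf; rewrite /F => ->.
move=> E; pose M := (p + \max_(e < E) \max_(b : digits) size (c e b))%N.
(* Beyond this degree some exponent exceeds [M]; as [p <= M], it is the last one, where every
   [c e b] with [e < E] has coefficient zero. *)
exists (m.+1 * M).+1 => al h; rewrite /F; case: ifP => // low_al.
apply/(@eqmodZP p pr _ _ _); rewrite -[zeroZ p : R]/(0 : R) subr0.
have := hL (low_part al, al ord_max) E; rewrite /s big1 ?subr0 // => e _ /=.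
rewrite nth_default ?mulr0 // leqNgt; apply: contraL h => hlt.
rewrite -leqNgt /mdeg; apply: (@leq_trans (\sum_(i < m.+1) M)%N).
  apply: leq_sum => i _; case: (unliftP ord_max i) => [j ->|->].
    by apply: leq_trans (leq_addr _ _); apply/ltnW; move/forallP: low_al; apply.
  apply: leq_trans (ltnW hlt) _; apply: leq_trans (leq_addl _ _).
  apply: leq_trans (leq_bigmax e); exact: leq_bigmax (low_part al).
by rewrite sum_nat_const card_ord.
Qed.

End Series.

(** * Existence and uniqueness of the representing series *)

Section Representation.
Variables (p : nat) (pr : prime p) (m : nat).
Local Notation R := (padic pr).
Local Notation orbit a := (fun i : nat => iter i (@deltaR p pr) a).

(** A one-variable series is the case of no low variables, where [digits] has the empty function as
    its only element. *)
Lemma analytic_expansion (f : R -> R) : analytic_level m f ->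
  forall a : R, exists q : nat -> {poly R}, forall E u,
    dvd (p%:R ^+ E) (f (a + p%:R ^+ m * u) - \sum_(e < E) p%:R ^+ e * (q e).[u]).
Proof.
move=> hf a; have [Fa [rFa hFa]] := hf a.
have lFa : low_degree (m := 0) Fa by move=> al [i]; rewrite ltn0.
have [c hc _] := digit_expands pr (m := 0) rFa.
exists (fun e => \sum_b c e b) => E u.
have := (series_eval_expands (fun=> u) _ lFa hc).1 (hFa u) E.
rewrite (natZE pr) natrX -[addZ _ _]/(a + p%:R ^+ m * u).
congr (dvd _ (_ - _)); apply: eq_bigr => e _; congr (_ * _).
rewrite /low_eval horner_sum; apply: eq_bigr => b _.
by rewrite /monomial big_ord0 mul1r.
Qed.

Lemma residue_split (x : R) : exists (n : 'I_(p ^ m)) (u : R), x = n%:R + p%:R ^+ m * u.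
Proof.
have [u hu] := dvd_sub_res x m.
by exists (Ordinal (res_lt pr x m)), u; rewrite -hu addrC subrK.
Qed.

Lemma represents_exists (f : R -> R) : analytic_level m f ->
  exists F : pseries p m.+1, [/\ restricted F, low_degree F & represents f F].
Proof.
move=> hf.
have /choice[X hX] (n : 'I_(p ^ m)) : exists X, curve_spec m (n%:R : R) X by apply: curve_exists.
have /choice[q hq] (n : 'I_(p ^ m)) := analytic_expansion hf n%:R.
have [c hc] := expansion_pull hX q.
have [F [rF lF eF]] := series_of_expansion c.
exists F; split => // x; apply/(series_eval_expands (orbit x) _ lF eF) => E.
(* On the ball of [x], the expansion of [F] is the pulled-back one evaluated at [u]. *)
have [n [u ->]] := residue_split x.
apply: (dvd_trans_sub (hq n E u)).
have [z hz] := hc n E; exists z.[u].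
have := congr1 (fun P : {poly R} => P.[u]) hz.
rewrite hornerM horner_exp horner_natr hornerD hornerN !horner_sum => <-.
congr (_ - _); apply: eq_bigr => e _; rewrite hornerM horner_exp horner_natr //.
by rewrite (horner_pull _ _ (hX n)).
Qed.

Lemma represents_unique (f : R -> R) (F G : pseries p m.+1) :
  restricted F -> low_degree F -> represents f F ->
  restricted G -> low_degree G -> represents f G -> G = F.
Proof.
move=> rF lF hF rG lG hG.
have /choice[X hX] (n : 'I_(p ^ m)) : exists X, curve_spec m (n%:R : R) X by apply: curve_exists.
have [c ec hc] := digit_expands pr rF; have [d ed hd] := digit_expands pr rG.
have digits_eq e (b : {ffun 'I_m -> 'I_p}) n : G (mindex_of b n) e = F (mindex_of b n) e.
  suff : d e b - c e b = 0.
    move/(congr1 (fun P : {poly R} => red P`_n)).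
    rewrite coefB coef0 hc hd rmorphB rmorph0 /= !rmorph_nat.
    move/eqP; rewrite subr_eq0 => /eqP h; apply: val_inj.
    by apply: natr_Fp_inj h; rewrite ?digit_lt.
  move: e b {n}; apply: (expansion_unique hX) => [e b i|n E u].
    (* Two digits congruent modulo [p] are equal, so their difference vanishes. *)
    rewrite coefB hc hd => /red_eq0_dvd; rewrite rmorphB /= !rmorph_nat.
    by move/eqP; rewrite subr_eq0 => /eqP/natr_Fp_inj ->; rewrite ?subrr ?digit_lt.
  pose x : R := n%:R + p%:R ^+ m * u.
  have h1 := (series_eval_expands (orbit x) _ lF ec).1 (hF x) E.
  have h2 := (series_eval_expands (orbit x) _ lG ed).1 (hG x) E.
  have := dvd_sub h1 h2; congr dvd.
  rewrite opprB addrC addrA subrK.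
  rewrite -sumrB; apply: eq_bigr => e _; rewrite (horner_pull _ _ (hX n)) -mulrBr; congr (_ * _).
  by rewrite /low_eval -sumrB; apply: eq_bigr => b _; rewrite hornerD hornerN mulrBr.
apply: funext => al; have [low_al|nlow] := boolP (low p al).
  by rewrite -(mindex_ofK pr low_al); apply: funext => e; apply: digits_eq.
by rewrite ((low_degreeP F).1 lF _ nlow) ((low_degreeP G).1 lG _ nlow).
Qed.

End Representation.

Theorem theorem5p1 (p m : nat) (f : Zp p -> Zp p) :
  prime p -> analytic_level m f ->
  exists F : pseries p m.+1,
    (restricted F /\ low_degree F /\ represents f F) /\
    (forall G : pseries p m.+1,
        restricted G /\ low_degree G /\ represents f G -> G = F).
Proof.
move=> pr hf; have [F [rF lF hF]] := @represents_exists p pr m f hf.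
exists F; split=> // G [rG [lG hG]].
exact: (@represents_unique p pr m f).
Qed.
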